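(* Let $G$ be an amenable locally compact group. If $G$ is relatively hyperbolic, then $G$ is hyperbolic.
   Context: A locally compact group is (Gromov-)hyperbolic if it admits a compact generating set such that the associated word metric is Gromov-hyperbolic. Let $G$ be a locally compact group acting continuously and properly by isometries on a proper hyperbolic geodesic metric space $X$ with Gromov boundary $\partial X$. A point $\xi\in\partial X$ is a conical limit point if for some (hence any) geodesic ray $\varrho$ pointing to $\xi$, some tubular neighbourhood of $\varrho$ intersects a $G$-orbit in an unbounded set; $\xi$ is bounded parabolic if the stabilizer $G_\xi$ acts cocompactly on $\partial X\setminus\{\xi\}$. The $G$-action is cusp-uniform if every point of $\partial X$ is a conical limit point or a non-isolated bounded parabolic point. $G$ is relatively hyperbolic if it admits some proper continuous cusp-uniform isometric action on a proper hyperbolic geodesic metric space. *)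

(* Defs.v *)
From HB Require Import structures.
From mathcomp Require Import all_boot all_order all_algebra generic_quotient.
From mathcomp Require Import boolp classical_sets functions reals.
From mathcomp Require Import topology normedtype.

Set Implicit Arguments.
Unset Strict Implicit.
Unset Printing Implicit Defensive.

Import Order.TTheory GRing.Theory Num.Theory.
Import numFieldTopology.Exports numFieldNormedType.Exports.

Local Open Scope classical_set_scope.
Local Open Scope ring_scope.

HB.mixin Record isTopologicalGroup G of Group G & Topological G := {
  mulg_continuous : continuous (fun p : G * G => (p.1 * p.2)%g);
  invg_continuous : continuous (fun x : G => x^-1%g)
}.

#[short(type="topologicalGroupType")]
HB.structure Definition TopologicalGroup :=
  {G of isTopologicalGroup G & Group G & Topological G}.

Section groups.
Context (R : realType) (G : topologicalGroupType).

(* Hausdorff is part of the usual convention for locally compact groups. *)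
Definition locally_compact_group :=
  hausdorff_space G /\ locally_compact [set: G].

Definition bounded_continuous (f : G -> R) :=
  continuous f /\ bounded_fun f.

(* A left-invariant mean on the space of bounded continuous functions. Only
   the values of [m] on that space matter. *)
Definition left_invariant_mean (m : (G -> R) -> R) :=
  [/\ forall (a : R) f h, bounded_continuous f -> bounded_continuous h ->
        m (fun x => a * f x + h x) = a * m f + m h,
      forall f, bounded_continuous f -> (forall x, 0 <= f x) -> 0 <= m f,
      m (fun=> 1) = 1
    & forall g f, bounded_continuous f -> m (fun x => f (g * x)%g) = m f].

Definition amenable := exists m, left_invariant_mean m.

Definition words (S : set G) (g : G) : set (seq G) :=
  [set w | (forall s, s \in w -> S s \/ S s^-1%g) /\
           (\prod_(s <- w) s)%g = g].

Definition generating (S : set G) := forall g, words S g !=set0.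

(* The infimum is attained when [S] generates [G], being that of a nonempty
   set of natural numbers. *)
Definition word_dist (S : set G) (x y : G) : R :=
  inf [set (size w)%:R | w in words S (x^-1 * y)%g].

End groups.

Section gromov_hyperbolicity.
Context (R : realType) (T : Type) (d : T -> T -> R).

Definition gromov_product (w x y : T) : R := (d w x + d w y - d x y) / 2.

Definition gromov_hyperbolic := exists delta : R, forall w x y z,
  Num.min (gromov_product w x y) (gromov_product w y z) - delta
    <= gromov_product w x z.

End gromov_hyperbolicity.

Definition hyperbolic_group (R : realType) (G : topologicalGroupType) :=
  exists S : set G,
    [/\ compact S, generating S & gromov_hyperbolic (@word_dist R G S)].

Definition half_line (R : realType) : Type := [set t : R | 0 <= t].
HB.instance Definition _ (R : realType) := Topological.on (half_line R).

Section metric_spaces.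
Context (R : realType) (X : metricType R).

Definition proper_space := forall (x : X) (r : R),
  compact [set y | mdist x y <= r].

Definition geodesic_space := forall x y : X, exists c : R -> X,
  [/\ c 0 = x, c (mdist x y) = y
    & forall s t, 0 <= s <= mdist x y -> 0 <= t <= mdist x y ->
        mdist (c s) (c t) = `|s - t|].

Definition bounded_subset (A : set X) :=
  exists M : R, forall x y, A x -> A y -> mdist x y <= M.

Definition geodesic_rays : set {compact-open, half_line R -> X} :=
  [set c | forall s t, mdist (c s) (c t) = `|\val s - \val t|].

Definition geodesic_ray : Type := geodesic_rays.
HB.instance Definition _ := Topological.on geodesic_ray.

Definition asymptotic : rel geodesic_ray := fun c c' =>
  `[< exists M : R, forall t, mdist (\val c t) (\val c' t) <= M >].

Lemma asymptotic_refl : reflexive asymptotic.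
Proof. by move=> c; apply/asboolP; exists 0 => t; rewrite mdistxx. Qed.

Lemma asymptotic_sym : symmetric asymptotic.
Proof.
by move=> c c'; apply/asboolP/asboolP => -[M cM]; exists M => t; rewrite metric_sym.
Qed.

Lemma asymptotic_trans : transitive asymptotic.
Proof.
move=> c2 c1 c3 /asboolP[M cM] /asboolP[N cN]; apply/asboolP; exists (M + N) => t.
exact: le_trans (metric_triangle _ (\val c2 t) _) (lerD (cM t) (cN t)).
Qed.

Canonical asymptotic_equiv :=
  EquivRel asymptotic asymptotic_refl asymptotic_sym asymptotic_trans.

(* Rays with arbitrary origin are used, so that no base point is involved. When
   [X] is a proper geodesic hyperbolic space this is the usual topology: on such
   spaces, asymptotic classes depend continuously on the ray for the topology of
   uniform convergence on compact sets, and the compact space of rays issued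
   from a base point maps onto the Hausdorff space of classes. *)
Definition gromov_boundary : Type :=
  quotient_topology {eq_quot asymptotic}%qT.
HB.instance Definition _ := Topological.on gromov_boundary.

Definition endpoint (c : geodesic_ray) : gromov_boundary :=
  \pi_({eq_quot asymptotic})%qT c.

Definition tubular_neighbourhood (c : geodesic_ray) (r : R) : set X :=
  [set x | exists t, mdist x (\val c t) < r].

End metric_spaces.

Record isometric_action (R : realType) (G : topologicalGroupType)
    (X : metricType R) := IsometricAction {
  iact :> G -> X -> X;
  iact1 : forall x, iact 1%g x = x;
  iactM : forall g h x, iact (g * h)%g x = iact g (iact h x);
  iact_isometry : forall g x y, mdist (iact g x) (iact g y) = mdist x y
}.

Section actions.
Context (R : realType) (G : topologicalGroupType) (X : metricType R).
Variable a : isometric_action G X.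

Definition continuous_action := continuous (fun p : G * X => a p.1 p.2).

Definition proper_action := forall K : set X, compact K ->
  precompact [set g | (a g @` K) `&` K !=set0].

Definition action_orbit (x : X) : set X := [set a g x | g in [set: G]].

Lemma ray_act_subproof (g : G) (c : geodesic_ray X) :
  (fun t => a g (\val c t)) \in @geodesic_rays R X.
Proof.
by rewrite inE => s t; rewrite iact_isometry; have /set_mem := valP c; exact.
Qed.

Definition ray_act (g : G) (c : geodesic_ray X) : geodesic_ray X :=
  exist (fun c => c \in @geodesic_rays R X) _ (ray_act_subproof g c).

Definition boundary_act (g : G) (xi : gromov_boundary X) : gromov_boundary X :=
  endpoint (ray_act g (repr xi)).

Lemma boundary_act_endpoint g c :
  boundary_act g (endpoint c) = endpoint (ray_act g c).
Proof.
have /eqmodP/asboolP[M cM] : \pi_({eq_quot (@asymptotic R X)})%qT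
    (repr (endpoint c)) = \pi_({eq_quot (@asymptotic R X)})%qT c by rewrite reprK.
by apply/eqmodP/asboolP; exists M => t; rewrite iact_isometry.
Qed.

Definition boundary_stabilizer (xi : gromov_boundary X) : set G :=
  [set g | boundary_act g xi = xi].

Definition conical_limit_point (xi : gromov_boundary X) :=
  exists c : geodesic_ray X, endpoint c = xi /\
  exists (r : R) (x : X), 0 < r /\
    ~ bounded_subset (tubular_neighbourhood c r `&` action_orbit x).

Definition bounded_parabolic (xi : gromov_boundary X) :=
  exists K : set (gromov_boundary X), [/\ compact K, K `<=` ~` [set xi]
    & \bigcup_(g in boundary_stabilizer xi) (boundary_act g @` K) = ~` [set xi]].

Definition isolated_point (xi : gromov_boundary X) := open [set xi].

Definition cusp_uniform := forall xi : gromov_boundary X,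
  conical_limit_point xi \/ (~ isolated_point xi /\ bounded_parabolic xi).

End actions.

(* The space is required to be nonempty: every group acts on the empty space. *)
Definition relatively_hyperbolic (R : realType) (G : topologicalGroupType) :=
  exists (X : metricType R) (a : isometric_action G X),
    [/\ [set: X] !=set0, proper_space X, geodesic_space X
      & gromov_hyperbolic (@mdist R X)] /\
    [/\ continuous_action a, proper_action a & cusp_uniform a].

(* Main.v *)
Require Import Defs.
From mathcomp Require Import reals.
From mathcomp Require Import all_boot all_order all_algebra generic_quotient.
From mathcomp Require Import boolp classical_sets functions.
From mathcomp Require Import topology normedtype.
From mathcomp Require Import zify lra.

(** Let G be amenable with a cusp-uniform action on a proper hyperbolic geodesic
    space X. The point is that every boundary point is conical; the rest is
    classical.

    Suppose that xi is not conical, so that xi is a non-isolated bounded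
    parabolic point. Its stabilizer has unbounded orbits
    ([parabolic_unbounded]): a bounded set of isometries fixing xi moves a
    compact set avoiding xi to a set that stays away from xi, and this set
    would be the whole complement of xi.

    Amenability enters through [mean_concentrates]. Let B be the complement of a
    neighbourhood of xi in X. Two translates gB and hB by elements of the
    stabilizer can only meet if the orbit points g o and h o lie on a common
    geodesic ray to xi, up to a bounded error. Since xi is not conical, this
    fails as soon as g o and h o are far apart. As the stabilizer is unbounded,
    B has three disjoint translates, so an invariant mean, transported to X by
    an orbit map, gives B mass at most 1/3. For two distinct non-conical points
    xi and zeta the corresponding sets can be chosen to cover X, which is absurd
    ([concentration_unique]). So xi is the only non-conical point, and G fixes
    it.

    Since xi is not isolated, there is another boundary point zeta, which is
    conical. If orbit points g o run along a ray to zeta, then o lies close to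
    a geodesic from g o to xi = g xi, hence g^-1 o lies close to a
    geodesic ray from o to xi: this makes xi conical, a contradiction
    ([fixed_point_conical]).

    When all boundary points are conical, the action is cobounded
    ([conical_cobounded]): otherwise some points far from the orbit of x, but
    having x as almost nearest orbit point, converge to a boundary point, and orbit
    points along the ray to this limit are nearer than x to some of them.

    A proper cobounded action makes G hyperbolic
    ([cobounded_hyperbolic_group]). The elements moving x by at most C, with C
    large compared to the hyperbolicity constant and to the codiameter of the
    orbit of x, form a compact generating set. Applied to x, the word geodesics
    for this set give sequences of points that hardly backtrack, which a short
    induction turns into proximity to the geodesics of X ([geodesic_excess]), so
    that the centers of triangles in X are also centers for the word metric
    ([chain_length_hyperbolic]). *)

Set Implicit Arguments.
Unset Strict Implicit.
Unset Printing Implicit Defensive.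

Import Order.TTheory GRing.Theory Num.Theory.
Import numFieldTopology.Exports numFieldNormedType.Exports.

Local Open Scope classical_set_scope.
Local Open Scope ring_scope.

(** * Hyperbolicity of the metric of long steps *)

Lemma detour_length (xy xp py xz zy zp M : nat) :
  (xz <= xp + zp)%N -> (zy <= zp + py)%N -> (xp + py <= xy)%N -> (zp <= M)%N ->
  (xz + zy <= xy + 2 * M)%N.
Proof. lia. Qed.

Section chains.
Context (R : realType) (T : Type) (d : T -> T -> R).

(** The condition min((x|y)_w, (y|z)_w) - delta <= (x|z)_w, cleared of
    Gromov products. *)
Definition four_point (delta : R) := forall w x y z,
  d x z + d w y <= d w z + d x y + 2 * delta \/
  d x z + d w y <= d w x + d y z + 2 * delta.

Lemma hyperbolic_four_point (delta : R) :
  (forall w x y z,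
    Num.min (gromov_product d w x y) (gromov_product d w y z) - delta
      <= gromov_product d w x z) ->
  four_point delta.
Proof.
move=> h w x y z; have := h w x y z; rewrite /gromov_product.
by rewrite lerBlDr ge_min => /orP[] ?; [left|right]; lra.
Qed.

(** For the metric d g h = d(g x, h x) on a group, chains are the same as
    words in the elements that move x by at most C, so a chain of least length
    is a word geodesic. Working with chains keeps the group out of the
    hyperbolic geometry. *)
Definition chain (C : R) n x y := exists p : nat -> T,
  [/\ p 0%N = x, p n = y & forall i, (i < n)%N -> d (p i) (p i.+1) <= C].

Lemma chain_cat C m n x y z :
  chain C m x y -> chain C n y z -> chain C (m + n) x z.
Proof.
move=> [p [p0 pm pC]] [q [q0 qn qC]].
exists (fun i => if (i <= m)%N then p i else q (i - m)%N); split.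
- by [].
- case: leqP => h; last by rewrite addKn.
  by have n0 : n = 0%N; [lia|rewrite n0 addn0 pm -q0 -{1}n0 qn].
- move=> i imn; case: (ltngtP i m) => him.
  + by apply: pC.
  + by rewrite subSn; [apply: qC; lia|lia].
  + rewrite him pm subSn // subnn -q0; apply: qC; lia.
Qed.

Lemma chain_sub C n (p : nat -> T) i j : (i <= j <= n)%N ->
  (forall i, (i < n)%N -> d (p i) (p i.+1) <= C) -> chain C (j - i) (p i) (p j).
Proof.
move=> /andP[ij jn] pC; exists (fun k => p (i + k)%N); split.
- by rewrite addn0.
- by rewrite subnKC.
- by move=> k kij; rewrite addnS; apply: pC; lia.
Qed.

(** Twice the Gromov product (x|y)_z; it is small when z is close to a
    geodesic from x to y. *)
Definition excess x z y := d x z + d z y - d x y.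

Definition chain_length C (N : T -> T -> nat) :=
  (forall x y, chain C (N x y) x y) /\
  (forall n x y, chain C n x y -> (N x y <= n)%N).

(** The names stand for distances, c being a point that is nearly on geodesics
    from w to z and from x to y. *)
Lemma center_gromov_product (wx wy wz xy xz wc xc yc zc M : nat) :
  (wy <= wc + yc)%N -> (xz <= xc + zc)%N -> (wc + zc <= wz + M)%N ->
  (xc + yc <= xy + M)%N ->
  (wx%:R + wy%:R - xy%:R) / 2 <= (wx%:R + wz%:R - xz%:R) / 2 + M%:R :> R.
Proof.
move=> h1 h2 h3 h4; have : (wy + xz <= wz + xy + (M + M))%N by lia.
by rewrite -(ler_nat R) !natrD; lra.
Qed.

Section chain_metric.
Variables (delta C D E : R) (N : T -> T -> nat).
Hypothesis d_refl : forall x, d x x = 0.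
Hypothesis d_sym : forall x y, d x y = d y x.
Hypothesis d_tri : forall y x z, d x z <= d x y + d y z.
Hypothesis d4 : four_point delta.
Hypothesis delta0 : 0 <= delta.
Hypothesis D0 : 0 <= D.
Hypothesis d_coarse : forall x y (t : R), 0 <= t <= d x y ->
  exists z, d x z <= t + D /\ d z y <= d x y - t + D.
Hypothesis CE : C = E + 2 * D.
Hypothesis E_big : 12 * D + 5 * delta < E.
Hypothesis NC : chain_length C N.

Let E0 : 0 < E. Proof. move: E_big D0 delta0 CE; lra. Qed.

Let C0 : 0 < C. Proof. move: E_big D0 delta0 CE; lra. Qed.

Local Ltac hlra := move: E_big D0 delta0 CE E0 C0; lra.

Let d_ge0 x y : 0 <= d x y.
Proof. by have := d_tri y x x; rewrite d_refl (d_sym y x); hlra. Qed.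

Lemma chain_upper n x y : chain C n x y -> d x y <= n%:R * C.
Proof.
elim: n y => [|n IH] y [p [p0 pn pC]].
  by rewrite -p0 -pn d_refl mul0r.
have := d_tri (p n) x y.
have : d x (p n) <= n%:R * C.
  by apply: IH; exists p; split => // i ?; apply: pC; lia.
have := pC n (ltnSn n); rewrite pn -natr1 mulrDl; hlra.
Qed.

(** Each step of length C - D along a coarse geodesic, whose end is only known
    up to D, gains at least E = C - 2 D. *)
Lemma chain_exists n x y : d x y <= C + n%:R * E -> chain C n.+1 x y.
Proof.
elim: n y => [|n IH] y.
  rewrite mul0r addr0 => dC; exists (fun i => if i is 0%N then x else y).
  by split => // -[].
rewrite -natr1 mulrDl => dC.
suff [z [xz zy]] : exists z, d x z <= C + n%:R * E /\ d z y <= C.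
  rewrite -addn1; apply: chain_cat (IH _ xz) _.
  by exists (fun i => if i is 0%N then z else y); split => // -[].
have nE : 0 <= n%:R * E by apply: mulr_ge0 => //; hlra.
have [h|h] := lerP (d x y) (C - D).
  by exists x; rewrite d_refl; split; hlra.
have [|z [xz zy]] := @d_coarse x y (d x y - (C - D)).
  by apply/andP; split; hlra.
by exists z; split; hlra.
Qed.

(** A pair of points at distance less than (N - 1) E would be joined by a
    chain of fewer than N steps. *)
Lemma chain_length_lower x y : (N x y)%:R * E <= d x y + E.
Proof.
case Nxy: (N x y) => [|[|k]]; [by have := d_ge0 x y; rewrite mul0r; hlra
  |by have := d_ge0 x y; rewrite mul1r; hlra|].
rewrite -2!natr1 !mulrDl !mul1r leNgt; apply/negP => h.
have : chain C k.+1 x y by apply: chain_exists; hlra.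
by move/(NC.2); rewrite Nxy ltnn.
Qed.

Lemma chain_length_tri y x z : (N x z <= N x y + N y z)%N.
Proof. by apply: NC.2; apply: chain_cat; exact: NC.1. Qed.

Lemma chain_length_sym x y : N x y = N y x.
Proof.
suff le u v : (N u v <= N v u)%N by apply/eqP; rewrite eqn_leq !le.
apply: NC.2; have [p [p0 pn pC]] := NC.1 v u.
exists (fun i => p (N v u - i)%N); rewrite subn0 subnn; split => // i iN.
by have -> : (N v u - i = (N v u - i.+1).+1)%N; [lia|rewrite d_sym; apply: pC; lia].
Qed.

Let kappa := 12 * D + E + 4 * delta.

(** A sequence that progresses by at least E per step, up to one step, and by
    at most C = E + 2 D, hardly backtracks: over 6 steps the excess is at most
    12 D + E. For longer sequences, cut at three steps on either side of k: each
    cut changes the excess at p k by 2 delta only, because 2 E, the progress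
    made in three steps, exceeds kappa + delta, so that the other alternative of
    the four-point condition contradicts the induction hypothesis. The
    inequality E > 12 D + 5 delta says exactly this. *)
Lemma geodesic_excess n (p : nat -> T) :
  (forall i j, (i <= j <= n)%N -> d (p i) (p j) <= (j - i)%:R * C) ->
  (forall i j, (i <= j <= n)%N -> (j - i)%:R * E <= d (p i) (p j) + E) ->
  forall i k j, (i <= k <= j)%N -> (j <= n)%N ->
    excess (p i) (p k) (p j) <= kappa.
Proof.
move=> up low.
have short i k j : (i <= k <= j)%N -> (j <= n)%N -> (j - i <= 6)%N ->
    excess (p i) (p k) (p j) <= 12 * D + E.
  move=> /andP[ik kj] jn ij6; rewrite /excess.
  have h1 : d (p i) (p k) <= (k - i)%:R * C by apply: up; lia.
  have h2 : d (p k) (p j) <= (j - k)%:R * C by apply: up; lia.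
  have h3 : (j - i)%:R * E <= d (p i) (p j) + E by apply: low; lia.
  have h4 : (j - i)%:R * C = (k - i)%:R * C + (j - k)%:R * C.
    by rewrite -mulrDl -natrD; congr (_%:R * _); lia.
  have h5 : (j - i)%:R * C = (j - i)%:R * E + (j - i)%:R * (2 * D).
    by rewrite -mulrDr; congr (_ * _); rewrite CE; hlra.
  have : (j - i)%:R * (2 * D) <= 6 * (2 * D).
    by apply: ler_wpM2r; [hlra|rewrite ler_nat].
  hlra.
have triv a b : excess a a b <= kappa /\ excess a b b <= kappa.
  by rewrite /excess !d_refl /kappa; split; hlra.
suff H L i k j : (j - i <= L)%N -> (i <= k <= j)%N -> (j <= n)%N ->
    excess (p i) (p k) (p j) <= kappa.
  by move=> i k j; apply: H (leqnn _).
elim: L i k j => [|L IH] i k j ijL /andP[ik kj] jn.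
  have -> : k = i by lia.
  exact: (triv _ _).1.
have [<-|ik'] := eqVneq i k; first exact: (triv _ _).1.
have [->|kj'] := eqVneq k j; first exact: (triv _ _).2.
have three a b : (b - a = 3)%N -> (a <= b <= n)%N -> 2 * E <= d (p a) (p b).
  by move=> ba abn; have := low a b abn; rewrite ba; hlra.
(* r is the last point within three steps after k. *)
have [r [kr rj rk rE]] : exists r, [/\ (k <= r)%N, (r <= j)%N, (r <= k + 3)%N &
    excess (p i) (p k) (p j) <= excess (p i) (p k) (p r) + 2 * delta].
  have [jk3|jk3] := leqP j (k + 3); first by exists j; split => //; hlra.
  exists (k + 3)%N; split; [lia|lia|lia|].
  have h1 : excess (p k) (p (k + 3)%N) (p j) <= kappa by apply: IH; lia.
  have h2 : excess (p i) (p k) (p (k + 3)%N) <= kappa by apply: IH; lia.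
  have h3 : 2 * E <= d (p k) (p (k + 3)%N) by apply: three; lia.
  have := d_sym (p (k + 3)%N) (p j); have := d_sym (p i) (p k).
  rewrite /excess /kappa in h1 h2 *.
  by case: (d4 (p k) (p i) (p j) (p (k + 3)%N)) => ? ? ?; hlra.
suff : excess (p i) (p k) (p r) <= 12 * D + E + 2 * delta.
  by rewrite /kappa; hlra.
have [ki3|ki3] := leqP k (i + 3).
  have := short i k r; rewrite ik kr => /(_ isT); have -> : (r <= n)%N by lia.
  by have -> : (r - i <= 6)%N; [lia|move=> /(_ isT isT); hlra].
have h1 : excess (p i) (p (k - 3)%N) (p k) <= kappa by apply: IH; lia.
have h2 : excess (p (k - 3)%N) (p k) (p r) <= 12 * D + E by apply: short; lia.
have h3 : 2 * E <= d (p (k - 3)%N) (p k) by apply: three; lia.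
have := d_sym (p (k - 3)%N) (p k); have := d_sym (p i) (p k).
have := d_sym (p (k - 3)%N) (p i).
rewrite /excess /kappa in h1 h2 *.
by case: (d4 (p k) (p (k - 3)%N) (p i) (p r)) => ? ? ? ?; hlra.
Qed.

Lemma chain_geodesic x y : exists p : nat -> T,
  [/\ p 0%N = x, p (N x y) = y,
      forall i, (i < N x y)%N -> d (p i) (p i.+1) <= C,
      forall i, (i <= N x y)%N -> excess x (p i) y <= kappa
    & forall i, (i <= N x y)%N -> (N x (p i) + N (p i) y <= N x y)%N].
Proof.
have [p [p0 pn pC]] := NC.1 x y; exists p; split => //; last first.
  move=> i iN.
  have := NC.2 _ _ _ (@chain_sub C _ p 0%N i iN pC).
  have := NC.2 _ _ _ (@chain_sub C _ p i (N x y) _ pC).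
  by rewrite iN leqnn => /(_ isT); rewrite p0 pn; lia.
move=> i iN; rewrite -{1}p0 -{1}pn.
apply: (@geodesic_excess (N x y)) => // {i iN} i j.
  by move=> ijn; apply/chain_upper/(@chain_sub C (N x y)).
move=> ijn; apply: le_trans (chain_length_lower _ _).
apply: ler_wpM2r; first hlra.
rewrite ler_nat.
have := NC.2 _ _ _ (chain_cat (chain_cat (@chain_sub C (N x y) p 0%N i _ pC)
  (NC.1 (p i) (p j))) (@chain_sub C (N x y) p j (N x y) _ pC)).
by rewrite p0 pn; lia.
Qed.

Lemma discrete_ivt (f : nat -> R) n (t : R) : f 0%N <= t <= f n ->
  (forall i, (i < n)%N -> f i.+1 <= f i + C) ->
  exists2 i, (i <= n)%N & t - C <= f i <= t.
Proof.
move=> /andP[f0 fn]; elim: n fn => [|n IH] fn fC.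
  by exists 0%N => //; apply/andP; split; hlra.
have [tn|tn] := lerP t (f n).
  have [|i iN ti] := IH tn; first by move=> i iN; apply: fC; lia.
  by exists i => //; exact: leqW.
by exists n => //; apply/andP; split; have := fC n (ltnSn n); hlra.
Qed.

(** A point with small excess for d with respect to x and y is d-close to the
    point of the chain geodesic from x to y at the same distance from x, so it
    also has small excess for N. *)
Lemma excess_chain (k : R) : exists M : nat, forall x z y,
  excess x z y <= k -> (N x z + N z y <= N x y + M)%N.
Proof.
pose k1 := C + 2 * `|k| + 2 * kappa + 2 * delta.
have /ltW Mn := archi_boundP (normr_ge0 ((k1 + E) / E)).
pose n := Num.bound `|(k1 + E) / E|.
exists (2 * n)%N => x z y xzy.
have close w : d z w <= k1 -> (N z w <= n)%N.
  move=> zw; have : (N z w)%:R * E <= k1 + E.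
    by have := chain_length_lower z w; hlra.
  rewrite -ler_pdivlMr // => h; rewrite -(ler_nat R).
  exact: le_trans h (le_trans (ler_norm _) Mn).
have [p [p0 pn pC pE pN]] := chain_geodesic x y.
have knorm := ler_norm k.
have kap0 : 0 <= kappa by rewrite /kappa; hlra.
have [i iN /andP[it ti]] : exists2 i, (i <= N x y)%N &
    Num.min (d x z) (d x y) - C <= d x (p i) <= Num.min (d x z) (d x y).
  apply: (@discrete_ivt (fun i => d x (p i))).
    rewrite p0 pn d_refl ge_min lexx orbT andbT le_min !d_ge0 //.
  by move=> i iN; have := d_tri (p i) x (p i.+1); have := pC i iN; hlra.
suff zi : d z (p i) <= k1.
  have := chain_length_tri (p i) x z; rewrite (chain_length_sym (p i) z).
  move=> xz; have zy := chain_length_tri (p i) z y.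
  exact: detour_length xz zy (pN i iN) (close _ zi).
have := pE i iN; rewrite /excess in xzy *.
have := d_sym (p i) x; have := d_sym (p i) y.
have := d_sym z x; have := d_sym y z; have := d_ge0 z y; have := d_sym y x.
have := normr_ge0 k.
move: ti it; rewrite le_min lerBlDr ge_min => /andP[? ?].
rewrite /k1; case/orP => ?;
  by case: (d4 x z y (p i)) => ? ? ? ? ? ? ? ? ?; hlra.
Qed.

(** Given w, x, z, some point c of the chain geodesic from x to z is a center
    of the triangle: its three d-excesses are small, hence so are its three
    N-excesses, and N w c equals the N-Gromov product (x|z)_w up to a constant.
    The four-point condition for d, applied at c, bounds the excess of c for
    (x, y) or (y, z), hence one of (x|y)_w, (y|z)_w by N w c. *)
Lemma chain_length_hyperbolic :
  gromov_hyperbolic (fun x y => (N x y)%:R : R).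
Proof.
pose k := 2 * kappa + 2 * C + 2 * delta.
have kap0 : 0 <= kappa by rewrite /kappa; hlra.
have [M HM] := excess_chain (k + 2 * delta).
exists M%:R => w x y z.
have [p [p0 pn pC pE pN]] := chain_geodesic x z.
(* The distance from x to the center of a tripod with ends w, x, z. *)
pose t := (d x w + d x z - d w z) / 2.
have tE : 2 * t = d x w + d x z - d w z by rewrite /t; hlra.
have [i iN /andP[it ti]] : exists2 i, (i <= N x z)%N & t - C <= d x (p i) <= t.
  apply: (@discrete_ivt (fun i => d x (p i))).
    rewrite p0 pn d_refl.
    have := d_tri x w z; have := d_tri z x w; rewrite (d_sym w x) (d_sym z w).
    by move=> ? ?; apply/andP; split; hlra.
  by move=> i iN; have := d_tri (p i) x (p i.+1); have := pC i iN; hlra.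
set c := p i in it ti.
have xcz : excess x c z <= kappa := pE i iN.
have xcw : excess x c w <= k.
  rewrite /excess /k in xcz *.
  have := d_sym c x; have := d_sym c z; have := d_sym w z; have := d_sym w c.
  by case: (d4 x c z w) => ? ? ? ? ?; hlra.
have wcz : excess w c z <= k.
  rewrite /excess /k in xcz *.
  have := d_sym c x; have := d_sym c z; have := d_sym w z; have := d_sym w c.
  have := d_sym x z; have := d_sym x w; have := d_tri c z x.
  by case: (d4 z c x w) => ? ? ? ? ? ? ? ?; hlra.
have Nxw : (N x c + N c w <= N x w + M)%N by apply: HM; hlra.
have Nwz : (N w c + N c z <= N w z + M)%N by apply: HM; hlra.
have Nxz : (N x z <= N x c + N c z)%N := chain_length_tri c x z.
have Ny : (N w y <= N w c + N c y)%N := chain_length_tri c w y.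
have [xy|yz] : excess x c y <= k + 2 * delta \/ excess y c z <= k + 2 * delta.
  rewrite /excess /k in xcz *.
  have := d_sym c x; have := d_sym c y.
  by case: (d4 c x y z) => ? ? ?; [left|right]; hlra.
- have Nxy : (N x c + N c y <= N x y + M)%N by apply: HM.
  rewrite lerBlDr ge_min; apply/orP; left; rewrite /gromov_product.
  exact: center_gromov_product Ny Nxz Nwz Nxy.
- have Nyz : (N y c + N c z <= N y z + M)%N by apply: HM.
  rewrite lerBlDr ge_min; apply/orP; right; rewrite /gromov_product.
  rewrite (addrC (N w y)%:R) (addrC (N w x)%:R).
  rewrite (chain_length_sym x c) addnC in Nxz.
  rewrite (chain_length_sym x c) (chain_length_sym x w) addnC in Nxw.
  rewrite (chain_length_sym y c) addnC in Nyz.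
  rewrite (chain_length_sym c w) in Nxw.
  exact: center_gromov_product Ny Nxz Nxw Nyz.
Qed.

End chain_metric.
End chains.

(** * From cobounded actions to word metrics *)

Lemma chain_length_exists (R : realType) T (d : T -> T -> R) (C : R) :
  (forall x y, exists n, chain d C n x y) -> exists N, chain_length d C N.
Proof.
move=> h.
have h' x y : exists n, `[< chain d C n x y >].
  by have [n /asboolP] := h x y; exists n.
exists (fun x y => ex_minn (h' x y)); split=> [x y|n x y cn].
  by case: ex_minnP => n /asboolP.
by case: ex_minnP => m _; apply; apply/asboolP.
Qed.

Lemma hyperbolic_four_point_ge0 (R : realType) T (d : T -> T -> R) :
  gromov_hyperbolic d -> exists2 delta, 0 <= delta & four_point d delta.
Proof.
move=> [delta /hyperbolic_four_point d4]; exists `|delta|; first exact: normr_ge0.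
move=> w x y z; have := ler_norm delta.
by case: (d4 w x y z) => ? ?; [left|right]; lra.
Qed.

Section action.
Context (R : realType) (G : topologicalGroupType) (X : metricType R).
Variable a : isometric_action G X.

Definition cobounded_action := exists (x : X) (D : R),
  forall y, exists g, mdist y (a g x) <= D.

Lemma iactKV g x : a g (a g^-1%g x) = x.
Proof. by rewrite -iactM mulgV iact1. Qed.

Lemma mdist_iactV g x y : mdist (a g^-1%g x) y = mdist x (a g y).
Proof. by rewrite -(iact_isometry a g) iactKV. Qed.

Definition displacement_ball (x : X) (C : R) : set G :=
  [set g | mdist x (a g x) <= C].

Lemma displacement_ballV x C g :
  displacement_ball x C g^-1%g -> displacement_ball x C g.
Proof. by rewrite /displacement_ball /= metric_sym mdist_iactV. Qed.

Lemma words_chain x C (g h : G) w :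
  words (displacement_ball x C) (g^-1 * h)%g w ->
  chain (fun g h => mdist (a g x) (a h x)) C (size w) g h.
Proof.
move=> [wS wgh]; exists (fun i => g * \prod_(s <- take i w) s)%g; split.
- by rewrite take0 big_nil mulg1.
- by rewrite take_size wgh mulgA mulgV mul1g.
move=> i iw; rewrite (take_nth 1%g iw) -cats1 big_cat big_seq1 /= mulgA.
rewrite [X in mdist _ X]iactM iact_isometry.
have [//|] := wS _ (mem_nth 1%g iw); exact: displacement_ballV.
Qed.

Lemma chain_words x C (g h : G) n :
  chain (fun g h => mdist (a g x) (a h x)) C n g h ->
  exists2 w, words (displacement_ball x C) (g^-1 * h)%g w & size w = n.
Proof.
move=> [p [p0 pn pC]]; exists (mkseq (fun i => (p i)^-1 * p i.+1)%g n).
  split.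
    move=> s /mapP[i]; rewrite mem_iota add0n => /andP[_ iN ->]; left.
    rewrite /displacement_ball /= -(iact_isometry a (p i)) -iactM mulgA mulgV mul1g.
    exact: pC.
  rewrite -p0 -pn big_map; elim: n {pn pC} => [|n IH].
    by rewrite big_nil mulVg.
  rewrite -(addn1 n) iotaD big_cat /= IH big_seq1 add0n addn1.
  by rewrite -mulgA (mulgA (p n)) mulgV mul1g.
by rewrite size_mkseq.
Qed.

Lemma word_dist_chain_length x C N :
  chain_length (fun g h => mdist (a g x) (a h x)) C N ->
  @word_dist R G (displacement_ball x C) = fun g h => (N g h)%:R.
Proof.
move=> [NC Nmin]; apply/funext => g; apply/funext => h; rewrite /word_dist.
have [w w1 w2] := chain_words (NC g h).
have lb : lbound [set ((size w)%:R : R) |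
    w in words (displacement_ball x C) (g^-1 * h)%g]
    ((N g h)%:R : R).
  move=> _ [v vw <-]; rewrite ler_nat; apply: Nmin; exact: words_chain.
apply/eqP; rewrite eq_le; apply/andP; split.
  by apply: ge_inf; [exists (N g h)%:R|exists w => //; rewrite w2].
by apply: lb_le_inf => //; exists (size w)%:R; exists w.
Qed.

Lemma action_continuous x : continuous_action a -> continuous (a^~ x).
Proof.
move=> ac g; apply: (@continuous_comp _ _ _ (fun g => (g, x))
  (fun p : G * X => a p.1 p.2)); last exact: ac.
by apply: cvg_pair => //=; exact: cvg_cst.
Qed.

(** Properness of the action makes the displacement ball precompact, and its
    continuity makes it closed. *)
Lemma displacement_ball_compact x C : proper_space X -> continuous_action a ->
  proper_action a -> compact (displacement_ball x C).
Proof.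
move=> Xp ac ap; have K := Xp x C.
rewrite -precompact_closed.
  apply: precompact_subset (ap _ K) => g gC.
  exists (a g x); split => //; exists x => //=.
  by rewrite mdistxx (le_trans _ gC) // mdist_ge0.
have : closed [set y : X | mdist x y <= C].
  by apply: compact_closed => //; exact: metric_hausdorff.
by apply: closed_comp => g _; exact: action_continuous.
Qed.

(** Word lengths for the displacement ball of radius C are the chain lengths
    of the orbit metric, which is coarsely geodesic because the orbit is
    D-dense in a geodesic space. *)
Lemma cobounded_hyperbolic_group : proper_space X -> geodesic_space X ->
  gromov_hyperbolic (@mdist R X) -> continuous_action a -> proper_action a ->
  cobounded_action -> hyperbolic_group R G.
Proof.
move=> Xp Xg /hyperbolic_four_point_ge0[delta delta0 d4] ac ap [x [D0 xD0]].
pose D := `|D0|; have D_ge0 : 0 <= D by exact: normr_ge0.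
have xD y : exists g, mdist y (a g x) <= D.
  by have [g gD] := xD0 y; exists g; exact: le_trans gD (ler_norm _).
pose E := 12 * D + 5 * delta + 1; pose C := E + 2 * D.
have E_big : 12 * D + 5 * delta < E by rewrite ltrDl.
pose d g h := mdist (a g x) (a h x).
have dxx g : d g g = 0 by exact: mdistxx.
have dsym g h : d g h = d h g by exact: metric_sym.
have dtri h g k : d g k <= d g h + d h k by exact: metric_triangle.
have dd4 : four_point d delta by move=> *; exact: d4.
have dcoarse g h (t : R) : 0 <= t <= d g h ->
    exists k, d g k <= t + D /\ d k h <= d g h - t + D.
  move=> /andP[t0 td]; have [c [c0 cd cst]] := Xg (a g x) (a h x).
  have [k kD] := xD (c t); exists k.
  have h1 : mdist (a g x) (c t) = t.
    rewrite -{1}c0 cst ?lexx ?t0 ?mdist_ge0 // sub0r normrN ger0_norm //.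
  have h2 : mdist (c t) (a h x) = d g h - t.
    rewrite -{1}cd cst ?lexx ?t0 ?mdist_ge0 // distrC ger0_norm // subr_ge0 //.
  have h3 := metric_triangle (a g x) (c t) (a k x).
  have h4 := metric_triangle (a k x) (c t) (a h x).
  by rewrite /d in td h2 *; rewrite (metric_sym (a k x) (c t)) in h4; split; lra.
have [N NC] : exists N, chain_length d C N.
  apply: chain_length_exists => g h.
  have E0 : 0 < E by lra.
  have := archi_boundP (normr_ge0 (d g h / E)); set n := Num.bound _ => dn.
  exists n.+1; apply: (chain_exists dxx delta0 D_ge0 dcoarse erefl E_big).
  have : d g h / E < n%:R by exact: le_lt_trans (ler_norm _) dn.
  by rewrite ltr_pdivrMr // => ?; rewrite /C; lra.
exists (displacement_ball x C); split.
- exact: displacement_ball_compact.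
- move=> g; have [w] := chain_words (NC.1 1%g g).
  by rewrite invg1 mul1g => gw _; exists w.
rewrite (word_dist_chain_length NC).
exact: (chain_length_hyperbolic dxx dsym dtri dd4 delta0 D_ge0 dcoarse erefl E_big NC).
Qed.

End action.

(** * Geodesic rays in hyperbolic spaces *)

Section rays.
Context (R : realType) (X : metricType R).
Implicit Types (c e : geodesic_ray X).

Lemma half_line_subproof (t : R) : Num.max 0 t \in [set t : R | 0 <= t].
Proof. by rewrite inE /= le_max lexx. Qed.

(** Truncating at 0 makes evaluation of rays a total function of a real. *)
Definition half_line_of (t : R) : half_line R :=
  exist (fun t : R => t \in [set t | 0 <= t]) _ (half_line_subproof t).

Lemma half_line_ofK (u : half_line R) : 0 <= \val u /\ half_line_of (\val u) = u.
Proof.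
have /set_mem/= u0 := valP u; split => //.
by apply: val_inj => /=; rewrite max_r.
Qed.

Definition ray_at c (t : R) : X := \val c (half_line_of t).

Lemma ray_atE c (u : half_line R) : \val c u = ray_at c (\val u).
Proof. by rewrite /ray_at (half_line_ofK u).2. Qed.

Lemma ray_dist c s t : 0 <= s -> 0 <= t ->
  mdist (ray_at c s) (ray_at c t) = `|s - t|.
Proof.
move=> s0 t0; have /set_mem := valP c.
by move=> /(_ (half_line_of s) (half_line_of t)) /=; rewrite !max_r.
Qed.

Lemma ray_dist0 c t : 0 <= t -> mdist (ray_at c 0) (ray_at c t) = t.
Proof. by move=> t0; rewrite ray_dist // sub0r normrN ger0_norm. Qed.

Lemma ray_dist_le c s t : 0 <= s <= t ->
  mdist (ray_at c s) (ray_at c t) = t - s.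
Proof.
move=> /andP[s0 st]; rewrite ray_dist ?(le_trans s0 st) //.
by rewrite distrC ger0_norm // subr_ge0.
Qed.

Lemma ray_of (p : R -> X) :
  (forall s t : R, 0 <= s -> 0 <= t -> mdist (p s) (p t) = `|s - t|) ->
  exists c, forall t, 0 <= t -> ray_at c t = p t.
Proof.
move=> pd.
have pP : (fun u : half_line R => p (\val u)) \in @geodesic_rays R X.
  by rewrite inE => s t; rewrite pd ?(half_line_ofK _).1.
exists (exist (fun f => f \in @geodesic_rays R X) _ pP) => t t0.
by rewrite /ray_at /= max_r.
Qed.

Lemma asymptoticP c e : reflect
  (exists M : R, forall t, 0 <= t -> mdist (ray_at c t) (ray_at e t) <= M)
  (asymptotic c e).
Proof.
apply: (equivP (asboolP _)); split=> -[M cM]; exists M => t; first by move=> _; exact: cM.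
by rewrite !ray_atE; apply: cM; exact: (half_line_ofK t).1.
Qed.

Lemma endpointP c e : endpoint c = endpoint e <-> asymptotic c e.
Proof. by split => [/eqmodP|h]; [|apply/eqmodP]. Qed.

Lemma endpoint_surj (xi : gromov_boundary X) : exists c, endpoint c = xi.
Proof. by exists (repr xi); rewrite /endpoint reprK. Qed.

Section hyperbolic.
Variable delta : R.
Hypothesis d4 : four_point (@mdist R X) delta.
Hypothesis delta0 : 0 <= delta.

Local Notation d := (@mdist R X).
Local Notation excess := (excess d).

(** The Gromov product based at c 0 of the points at time t is at least
    the least of three products: those of (c t, c s) and (e s, e t), which are
    about t since these points lie on a geodesic from c 0, or from e 0, and
    that of (c s, e s), which is about s - d(c s, e s) / 2. *)
Lemma fellow_travel c e D s t : 0 <= t <= s ->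
  d (ray_at c 0) (ray_at e 0) <= D ->
  d (ray_at c s) (ray_at e s) <= D + 2 * (s - t) ->
  d (ray_at c t) (ray_at e t) <= 3 * D + 4 * delta.
Proof.
move=> /andP[t0 ts] h0 hs; have s0 := le_trans t0 ts; have dl0 := delta0.
have c0s := ray_dist0 c s0; have c0t := ray_dist0 c t0.
have e0s := ray_dist0 e s0; have e0t := ray_dist0 e t0.
have cts : d (ray_at c t) (ray_at c s) = s - t by rewrite ray_dist_le ?t0.
have ets : d (ray_at e t) (ray_at e s) = s - t by rewrite ray_dist_le ?t0.
have D0 := mdist_ge0 (ray_at c 0) (ray_at e 0).
have h1 := metric_triangle (ray_at c 0) (ray_at e 0) (ray_at e t).
have h2 := metric_triangle (ray_at e 0) (ray_at c 0) (ray_at e s).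
have h3 := metric_sym (ray_at e 0) (ray_at c 0).
have h4 := metric_sym (ray_at e t) (ray_at e s).
have h5 := metric_triangle (ray_at e 0) (ray_at c 0) (ray_at e t).
by case: (d4 (ray_at c 0) (ray_at c t) (ray_at c s) (ray_at e s)) => ?;
  case: (d4 (ray_at c 0) (ray_at c t) (ray_at e s) (ray_at e t)) => ?; lra.
Qed.

Lemma asymptotic_close c e t : asymptotic c e -> 0 <= t ->
  d (ray_at c t) (ray_at e t) <= 3 * d (ray_at c 0) (ray_at e 0) + 4 * delta.
Proof.
move=> /asymptoticP[M cM] t0; have M0 := le_trans (mdist_ge0 _ _) (cM 0 (lexx 0)).
apply: (@fellow_travel _ _ _ (t + M)) => //; first by rewrite t0 lerDl.
by have := cM (t + M) (addr_ge0 t0 M0); have := mdist_ge0 (ray_at c 0) (ray_at e 0); lra.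
Qed.

(** Unbounded Gromov products of c t and e t force the rays to fellow travel
    for arbitrarily long times. *)
Lemma not_asymptotic_excess c e : ~~ asymptotic c e -> exists T, forall t,
  0 <= t -> excess (ray_at c t) (ray_at c 0) (ray_at e t) <= T.
Proof.
apply: contraNP => /forallNP h; apply/asymptoticP.
exists (3 * d (ray_at c 0) (ray_at e 0) + 4 * delta) => s s0.
have /existsNP[t /not_implyP[t0 /negP]] := h (2 * s); rewrite -ltNge => ht.
have h1 := ray_dist0 c t0; have h2 := ray_dist0 e t0.
have h3 := metric_triangle (ray_at c 0) (ray_at e 0) (ray_at e t).
have h4 := metric_triangle (ray_at c 0) (ray_at c t) (ray_at e t).
rewrite /excess (metric_sym (ray_at c t)) in ht.
by apply: (@fellow_travel _ _ _ t) => //; [apply/andP; split|]; lra.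
Qed.

(** Small excesses at o do not change much if the endpoint P is replaced by a
    point Q in the same direction from o; the error is independent of
    d(P, Q), so P and Q may be far points on two asymptotic rays. *)
Lemma excess_swap p o P Q k : excess p o P <= k ->
  k + 2 * delta < excess P o Q -> excess p o Q <= k + 2 * delta.
Proof.
rewrite /excess => h1 h2; have h3 := metric_sym o p; have h4 := metric_sym o Q.
by have h5 := metric_sym o P; have h6 := metric_sym Q P; case: (d4 o p Q P) => ?; lra.
Qed.

Lemma excess_close_to_ray c p k t : 0 <= t -> d (ray_at c 0) p <= t ->
  excess (ray_at c 0) p (ray_at c t) <= k ->
  d p (ray_at c (d (ray_at c 0) p)) <= k + 2 * delta.
Proof.
move=> t0; have := mdist_ge0 (ray_at c 0) p; set s := d _ p => s0 st.
rewrite /excess -/s => hk.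
have h1 := ray_dist0 c t0; have h2 := ray_dist0 c s0.
have h3 : d (ray_at c s) (ray_at c t) = t - s by rewrite ray_dist_le ?s0.
have h4 := metric_sym (ray_at c s) (ray_at c t).
have := metric_triangle (ray_at c 0) p (ray_at c t); rewrite -/s => h5.
by case: (d4 (ray_at c 0) p (ray_at c t) (ray_at c s)); rewrite -/s => ?;
  have := delta0; lra.
Qed.

Lemma asymptotic_excess c e p t : asymptotic c e -> 0 <= t ->
  2 * t - (d p (ray_at c 0) + d p (ray_at e 0)
    + 3 * d (ray_at c 0) (ray_at e 0) + 4 * delta)
  <= excess (ray_at c t) p (ray_at e t).
Proof.
move=> ce t0; have h1 := asymptotic_close ce t0.
have h2 := ray_dist0 c t0; have h3 := ray_dist0 e t0.
have h4 := metric_triangle (ray_at c 0) p (ray_at c t).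
have h5 := metric_triangle (ray_at e 0) p (ray_at e t).
rewrite /excess (metric_sym _ p).
by rewrite (metric_sym (ray_at c 0) p) (metric_sym (ray_at e 0) p) in h4 h5; lra.
Qed.

(** If the rays c and e tend to the same point xi, and both origins are near
    a geodesic from y to xi, then one origin is near the ray issued from the
    other. *)
Lemma common_shadow c e y k t : asymptotic c e -> 0 <= t ->
  k + 8 * delta + 4 * d (ray_at c 0) (ray_at e 0) < t ->
  excess y (ray_at c 0) (ray_at c t) <= k ->
  excess y (ray_at e 0) (ray_at e t) <= k ->
  exists s, 0 <= s /\
    (d (ray_at c 0) (ray_at e s) <= k + 6 * delta \/
     d (ray_at e 0) (ray_at c s) <= k + 6 * delta).
Proof.
move=> ce t0 tk yc ye; exists (d (ray_at c 0) (ray_at e 0)).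
split; first exact: mdist_ge0.
have k0 : 0 <= k.
  apply: le_trans yc; rewrite /excess subr_ge0; exact: metric_triangle.
have dl0 := delta0.
have D0 := mdist_ge0 (ray_at c 0) (ray_at e 0).
have PQ p := asymptotic_excess p ce t0.
have ye' : excess y (ray_at e 0) (ray_at c t) <= k + 2 * delta.
  apply: excess_swap ye _; have := PQ (ray_at e 0).
  rewrite mdistxx (metric_sym (ray_at e 0) (ray_at c 0)).
  rewrite /excess (metric_sym (ray_at e t) (ray_at e 0)).
  rewrite (metric_sym (ray_at e t) (ray_at c t)) (metric_sym (ray_at c t) (ray_at e 0)).
  by lra.
have [h|h] := d4 (ray_at e 0) y (ray_at c 0) (ray_at c t).
- left; rewrite (metric_sym (ray_at c 0) (ray_at e 0)).
  have k4 : k + 6 * delta = k + 2 * delta + 2 * delta + 2 * delta by lra.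
  rewrite k4; apply: (excess_close_to_ray t0).
    by rewrite metric_sym; lra.
  apply: (@excess_swap _ _ (ray_at c t)).
    move: h yc; rewrite /excess (metric_sym y (ray_at c t)).
    by rewrite (metric_sym (ray_at e 0) (ray_at c 0)) (metric_sym (ray_at c t) y); lra.
  have := PQ (ray_at c 0); rewrite mdistxx.
  by lra.
- right.
  have k4 : k + 6 * delta = k + 2 * delta + 2 * delta + 2 * delta by lra.
  rewrite k4; apply: (excess_close_to_ray t0); first lra.
  move: h ye'; rewrite /excess (metric_sym (ray_at e 0) y).
  by rewrite (metric_sym (ray_at e 0) (ray_at c 0)); lra.
Qed.
End hyperbolic.
End rays.

(** * Limits of rays and the topology of the boundary *)

Section limits.
Context (R : realType) (X : metricType R).
Hypothesis Xproper : proper_space X.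
Local Notation d := (@mdist R X).

Lemma ultralimit I (U : set_system I) (UU : UltraFilter U) (f : I -> X) x r :
  U [set i | d x (f i) <= r] ->
  exists y, forall e : R, 0 < e -> U [set i | d (f i) y < e].
Proof.
move=> Ur; have UP : ProperFilter U by exact: ultra_proper.
have [y [_ ycl]] := Xproper (x := x) (r := r)
  (F := f @ U) (fmap_proper_filter f UP) Ur.
exists y => e e0; have [//|nU] := in_ultra_setVsetC [set i | d (f i) y < e] UU.
have [||z [/= zf]] := ycl [set z | ~ d z y < e] (ball y e).
- exact: nU.
- exact: (nbhsx_ballx y e e0).
- by rewrite ballEmdist /= metric_sym.
Qed.

(** An ultrafilter provides limits at all times at once, and the condition of
    being isometric, which involves two times only, passes to the limit. *)
Lemma ray_ultralimit I (U : set_system I) (UU : UltraFilter U)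
    (f : I -> R -> X) (x : X) (b : R -> R) :
  (forall t : R, 0 <= t -> U [set i | d x (f i t) <= b t]) ->
  (forall s t : R, 0 <= s -> 0 <= t -> U [set i | d (f i s) (f i t) = `|s - t|]) ->
  exists c, forall t e : R, 0 <= t -> 0 < e -> U [set i | d (f i t) (ray_at c t) < e].
Proof.
move=> fb fd; have UP : ProperFilter U by exact: ultra_proper.
have /choice[p pP] : forall t : R, exists y, 0 <= t -> forall e : R, 0 < e ->
    U [set i | d (f i t) y < e].
  move=> t; have [t0|t0] := lerP 0 t; last by exists x => h; lra.
  by have [y yP] := ultralimit UU (fb t t0); exists y.
have [s t s0 t0|c cp] := @ray_of _ _ p; last first.
  by exists c => t e t0 e0; rewrite cp //; exact: pP.
have near e : 0 < e -> exists i, [/\ d (f i s) (p s) < e / 2,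
    d (f i t) (p t) < e / 2 & d (f i s) (f i t) = `|s - t|].
  move=> e0; have e20 : 0 < e / 2 by lra.
  have [i [[h1 h2] h3]] := filter_ex
    (filterI (filterI (pP s s0 _ e20) (pP t t0 _ e20)) (fd s t s0 t0)).
  by exists i.
apply/eqP; rewrite eq_le; apply/andP; split; apply/ler_addgt0Pr => e /near[i].
  move=> [h1 h2 <-]; have := metric_triangle (p s) (f i s) (p t).
  have := metric_triangle (f i s) (f i t) (p t).
  by rewrite (metric_sym (p s) (f i s)); lra.
move=> [h1 h2 <-]; have := metric_triangle (f i s) (p s) (f i t).
have := metric_triangle (p s) (p t) (f i t).
by rewrite (metric_sym (p t) (f i t)); lra.
Qed.

Lemma ultrafilter_nat : exists2 U : set_system nat, UltraFilter U &
  forall n, U [set m | (n <= m)%N].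
Proof.
have [U [UU hU]] := ultraFilterLemma (eventually_filter).
by exists U => // n; apply: hU; exact: nbhs_infty_ge.
Qed.

Section boundary_neighbourhoods.
Variable delta : R.
Hypothesis d4 : four_point d delta.
Hypothesis delta0 : 0 <= delta.

(** Limits are compatible with asymptotic classes because the distance between
    asymptotic rays is bounded in terms of their origins alone. *)
Lemma asymptotic_ultralimit I (U : set_system I) (UU : UltraFilter U)
    (e c : I -> geodesic_ray X) (c0 l : geodesic_ray X) (M : R) :
  U [set i | asymptotic (e i) (c i)] ->
  U [set i | d (ray_at (e i) 0) (ray_at c0 0) <= M] ->
  (forall t : R, 0 <= t -> U [set i | d (ray_at (c i) t) (ray_at l t) < 1]) ->
  exists2 k, asymptotic k l & forall t : R, 0 <= t ->
    U [set i | d (ray_at (e i) t) (ray_at c0 t) <= M] ->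
    d (ray_at k t) (ray_at c0 t) <= M.
Proof.
move=> Uec Ue0 Ucl; have UP : ProperFilter U by exact: ultra_proper.
have [t t0|s t s0 t0|k kP] := @ray_ultralimit I U UU (fun i => ray_at (e i))
    (ray_at c0 0) (fun t => M + t).
- apply: filterS Ue0 => i /= h; apply: le_trans (metric_triangle _ (ray_at (e i) 0) _) _.
  by rewrite metric_sym ray_dist0 // lerD2r.
- by apply: filterS filterT => i _; exact: ray_dist.
exists k.
  apply/asymptoticP; exists (3 * (M + d (ray_at c0 0) (ray_at l 0) + 1) + 4 * delta + 2).
  move=> t t0.
  have [i [[[[h1 h2] h3] h4] h5]] := filter_ex (filterI (filterI (filterI (filterI
    Uec Ue0) (Ucl t t0)) (Ucl 0 (lexx _))) (kP t 1 t0 ltr01)).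
  have h6 := asymptotic_close d4 delta0 h1 t0.
  have h7 := metric_triangle (ray_at k t) (ray_at (e i) t) (ray_at l t).
  have h8 := metric_triangle (ray_at (e i) t) (ray_at (c i) t) (ray_at l t).
  have h9 := metric_triangle (ray_at (e i) 0) (ray_at c0 0) (ray_at (c i) 0).
  have h10 := metric_triangle (ray_at c0 0) (ray_at l 0) (ray_at (c i) 0).
  rewrite (metric_sym (ray_at k t) (ray_at (e i) t)) in h7.
  rewrite (metric_sym (ray_at l 0)) in h10.
  by move: h2 h3 h4 h5 => /= h2 h3 h4 h5; lra.
move=> t t0 Ut; apply/ler_addgt0Pr => r r0.
have [i [h1 h2]] := filter_ex (filterI Ut (kP t r t0 r0)).
apply: le_trans (metric_triangle _ (ray_at (e i) t) _) _.
by move: h1 h2 => /= h1 h2; rewrite (metric_sym (ray_at k t) (ray_at (e i) t)); lra.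
Qed.

(** These sets decrease with n and have only the endpoint of c0 in common; being
    closed, they separate this endpoint from the compact sets avoiding it. *)
Definition fellow_classes (c0 : geodesic_ray X) (M : R) (n : nat) :
    set (gromov_boundary X) :=
  [set zeta | exists2 e, endpoint e = zeta &
    forall t : R, 0 <= t <= n%:R -> d (ray_at e t) (ray_at c0 t) <= M].

Lemma near_ray_at (c : geodesic_ray X) t r : 0 < r ->
  nbhs c [set e | d (ray_at e t) (ray_at c t) < r].
Proof.
move=> r0; pose O := (ball (ray_at c t) r)^°.
pose V : set {compact-open, half_line R -> X} :=
  [set f | f @` [set half_line_of t] `<=` O].
have oV : open V by apply: compact_open_open; [exact: compact_set1|exact: open_interior].
have nV : nbhs c (val @^-1` V).
  apply: open_nbhs_nbhs; split.
    by exists V.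
  move=> _ [_ -> <-] /=; exact: (nbhsx_ballx (ray_at c t) r r0).
apply: filterS nV => e /= eV.
have : O (ray_at e t) by apply: eV; exists (half_line_of t).
by move=> /interior_subset; rewrite ballEmdist /= metric_sym.
Qed.

(** The rays close to c0 up to time n form a compact set, and a limit of
    classes of such rays is the class of a limit of such rays. *)
Lemma fellow_classes_closed c0 M n : closed (fellow_classes c0 M n).
Proof.
rewrite -openC.
suff : closed [set c | fellow_classes c0 M n (endpoint c)] by rewrite -openC.
move=> l lcl; set B := [set c | _] in lcl.
have BP := within_nbhs_proper lcl.
have [U [UU hU]] := ultraFilterLemma BP; have UP : ProperFilter U by exact: ultra_proper.
have UB : U B by apply: hU; rewrite /within /=; apply: filterS filterT => ? _.
have /choice[e eP] : forall c, exists e, B c -> endpoint e = endpoint c /\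
    forall t : R, 0 <= t <= n%:R -> d (ray_at e t) (ray_at c0 t) <= M.
  move=> c.
  have [[e ec et]|nB] := pselect (B c); first by exists e.
  by exists c.
have [||t t0|k kl kM] := @asymptotic_ultralimit _ U UU e id c0 l M.
- by apply: filterS UB => c /eP[/endpointP].
- by apply: filterS UB => c /eP[_]; apply; rewrite lexx ler0n.
- apply: hU; apply: filterS (near_ray_at l t ltr01) => c //=.
exists k; first exact/endpointP.
move=> t t01; apply: kM; first by case/andP: t01.
by apply: filterS UB => c /eP[_]; apply.
Qed.

Lemma fellow_classes_point c0 M zeta :
  (forall n, fellow_classes c0 M n zeta) -> zeta = endpoint c0.
Proof.
move=> h; have [l lz] := endpoint_surj zeta; rewrite -lz.
have /choice[e eP] : forall n, exists e, endpoint e = zeta /\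
    forall t : R, 0 <= t <= n%:R -> d (ray_at e t) (ray_at c0 t) <= M.
  by move=> n; have [e ? ?] := h n; exists e.
have [U UU Un] := ultrafilter_nat; have UP : ProperFilter U by exact: ultra_proper.
have [||t t0|k kl kM] := @asymptotic_ultralimit _ U UU e (fun=> l) c0 l M.
- by apply: filterS filterT => i _; apply/endpointP; rewrite (eP i).1.
- by apply: filterS filterT => i _; apply: (eP i).2; rewrite lexx ler0n.
- by apply: filterS filterT => i _ /=; rewrite mdistxx.
apply/endpointP; apply: asymptotic_trans (_ : asymptotic k c0).
  by rewrite asymptotic_sym.
apply/asymptoticP; exists M => t t0; apply: kM => //.
have /ltW tb := archi_boundP t0.
apply: filterS (Un (Num.bound t)) => i /= bi; apply: (eP i).2.
by rewrite t0 (le_trans tb) // ler_nat.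
Qed.

End boundary_neighbourhoods.
End limits.

(** * Conical and parabolic points *)

Section boundary_dynamics.
Context (R : realType) (G : topologicalGroupType) (X : metricType R).
Variable a : isometric_action G X.
Local Notation d := (@mdist R X).
Local Notation excess := (excess d).

Lemma ray_at_act g (c : geodesic_ray X) t :
  ray_at (ray_act a g c) t = a g (ray_at c t).
Proof. by []. Qed.

Lemma excess_act g x y z : excess (a g x) (a g y) (a g z) = excess x y z.
Proof. by rewrite /excess !iact_isometry. Qed.

Lemma boundary_act_inv g zeta (c : geodesic_ray X) :
  boundary_act a g zeta = endpoint c -> zeta = endpoint (ray_act a g^-1%g c).
Proof.
have [e <-] := endpoint_surj zeta; rewrite boundary_act_endpoint.
move=> /endpointP/asymptoticP[M h]; apply/endpointP/asymptoticP.
exists M => t t0; rewrite ray_at_act metric_sym mdist_iactV metric_sym.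
exact: h.
Qed.

Lemma boundary_stabilizer_asymptotic g (c : geodesic_ray X) :
  boundary_stabilizer a (endpoint c) g -> asymptotic (ray_act a g c) c.
Proof. by rewrite /boundary_stabilizer /= boundary_act_endpoint => /endpointP. Qed.

(** Failure of the conical limit condition, with distances measured from the
    origin of the ray, which is where the geometric arguments need them. *)
Definition orbit_near_ray_bounded (c : geodesic_ray X) (x : X) (r : R) :=
  exists M : R, forall g s, 0 <= s ->
  d (a g x) (ray_at c s) < r -> d (a g x) (ray_at c 0) <= M.

Lemma conical_of_unbounded (c : geodesic_ray X) x r : 0 < r ->
  ~ orbit_near_ray_bounded c x r -> conical_limit_point a (endpoint c).
Proof.
move=> r0 h; exists c; split => //; exists r, x; split => // -[M hM]; apply: h.
have [[g1 [s1 [s10 h1]]]|h] := pselect (exists g1 s1,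
  0 <= s1 /\ d (a g1 x) (ray_at c s1) < r); last first.
  by exists 0 => g s s0 gs; exfalso; apply: h; exists g, s.
exists (M + d (a g1 x) (ray_at c 0)) => g s s0 gs.
apply: le_trans (metric_triangle _ (a g1 x) _) _; rewrite lerD2r.
apply: hM; split.
- by exists (half_line_of s).
- by exists g.
- by exists (half_line_of s1).
- by exists g1.
Qed.

Lemma conical_unbounded xi : conical_limit_point a xi -> exists c x r,
  [/\ endpoint c = xi, 0 < r & ~ orbit_near_ray_bounded c x r].
Proof.
move=> [c [cxi [r [x [r0 h]]]]]; exists c, x, r; split => // -[M hM]; apply: h.
exists (M + M) => y z [[t yt] [g _ gy]] [[t' zt] [g' _ gz]].
apply: le_trans (metric_triangle _ (ray_at c 0) _) _; apply: lerD.
  rewrite -gy; apply: (hM _ (\val t)); first exact: (half_line_ofK t).1.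
  by rewrite -ray_atE gy.
rewrite metric_sym -gz; apply: (hM _ (\val t')); first exact: (half_line_ofK t').1.
by rewrite -ray_atE gz.
Qed.

(** If the orbit of x is not cobounded, there are z n arbitrarily far from x
    with x as almost nearest orbit point. Let c be a limit of the geodesics from
    x to z n. An orbit point close to c s is closer to z n than x is, by almost s,
    once n is large. *)
Lemma conical_cobounded : proper_space X -> geodesic_space X ->
  [set: X] !=set0 -> (forall xi, conical_limit_point a xi) -> cobounded_action a.
Proof.
move=> Xp Xg [x _] con; apply: contrapT => ncob.
have far (n : nat) : exists z, n%:R < d x z /\ forall g, d x z <= d (a g x) z + 1.
  have [y yfar] : exists y, forall g, n%:R < d y (a g x).
    apply: contrapT => h; apply: ncob; exists x, n%:R => y.
    apply: contrapT => h'; apply: h; exists y => g; rewrite ltNge; apply/negP => gn.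
    by apply: h'; exists g.
  (* y is moved by the inverse of g0, where g0 x is almost nearest to y. *)
  pose A := [set d y (a g x) | g in [set: G]].
  have hA : has_inf A.
    split; first by exists (d y (a 1%g x)); exists 1%g.
    by exists 0 => _ [g _ <-]; exact: mdist_ge0.
  have [_ [g0 _ <-] g0A] := inf_adherent ltr01 hA.
  exists (a g0^-1%g y); split.
    by rewrite metric_sym mdist_iactV.
  move=> g; rewrite metric_sym mdist_iactV (metric_sym _ (a _ y)) mdist_iactV.
  rewrite -iactM; have : inf A <= d y (a (g0 * g)%g x).
    by apply: ge_inf; [exact: hA.2|exists (g0 * g)%g].
  by lra.
have /choice[z zP] := far.
have /choice[f fP] := fun n => Xg x (z n).
have [U UU Un] := ultrafilter_nat.
have UP : ProperFilter U by exact: ultra_proper.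
have Uz t : 0 <= t -> U [set n | t <= d x (z n)].
  move=> t0; have /ltW tb := archi_boundP t0.
  apply: filterS (Un (Num.bound t)) => n /= bn.
  by apply: le_trans tb (le_trans _ (ltW (zP n).1)); rewrite ler_nat.
have [t t0|s t s0 t0|c cP] := @ray_ultralimit _ _ Xp _ U UU f x id.
- apply: filterS (Uz t t0) => n /= tz; have [f0 _ fd] := fP n.
  by rewrite -{1}f0 fd ?lexx ?t0 ?mdist_ge0 // sub0r normrN ger0_norm.
- apply: filterS (filterI (Uz s s0) (Uz t t0)) => n /= [sz tz].
  by have [_ _ fd] := fP n; apply: fd; apply/andP.
(* The conical limit condition only holds for some ray e asymptotic to c. *)
have [e [x' [r [/endpointP/asymptoticP[M eM] r0]]]] :=
  conical_unbounded (con (endpoint c)).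
apply; pose K := r + M + d x' x + 3.
exists (K + r) => g s s0 gs; rewrite leNgt; apply/negP => far'.
have := ray_dist0 e s0; have := metric_triangle (a g x') (ray_at e s) (ray_at e 0).
rewrite (metric_sym (ray_at e s) (ray_at e 0)) => h1 h2.
have sK : K < s by lra.
have [n [/= sz fs]] := filter_ex (filterI (Uz s s0) (cP s 1 s0 ltr01)).
have [f0 fz fd] := fP n.
have h3 : d (f n s) (z n) = d x (z n) - s.
  rewrite -{1}fz fd ?lexx ?s0 ?mdist_ge0 // distrC ger0_norm // subr_ge0 //.
have h4 := (zP n).2 g.
have h5 := metric_triangle (a g x) (a g x') (z n).
have h6 := metric_triangle (a g x') (ray_at e s) (z n).
have h7 := metric_triangle (ray_at e s) (ray_at c s) (z n).
have h8 := metric_triangle (ray_at c s) (f n s) (z n).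
rewrite iact_isometry (metric_sym x x') in h5.
rewrite (metric_sym (ray_at c s) (f n s)) in h8.
by have := eM s s0; rewrite /K in sK; lra.
Qed.

Section hyperbolic.
Variable delta : R.
Hypothesis d4 : four_point d delta.
Hypothesis delta0 : 0 <= delta.
Hypothesis Xproper : proper_space X.

(** Suppose that the stabilizer moves x by at most B. As xi is not isolated,
    there are classes distinct from xi of rays c' that fellow travel c0 for a
    long time. If g in the stabilizer takes a point of K to such a class, this
    point is the class of g^-1 c', which still fellow travels c0 for a long
    time, within a distance M that depends only on B. But by compactness K
    misses [fellow_classes c0 M n] for some n. *)
Lemma parabolic_unbounded xi x : bounded_parabolic a xi -> ~ isolated_point xi ->
  forall B, exists2 g, boundary_stabilizer a xi g & B < d x (a g x).
Proof.
move=> [K [Kc Kxi KG]] nis B; apply: contrapT => nB.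
have gB g : boundary_stabilizer a xi g -> d x (a g x) <= B.
  by move=> gxi; rewrite leNgt; apply/negP => h; apply: nB; exists g.
have [c0 [c0xi nnb]] : exists c0, endpoint c0 = xi /\
    ~ nbhs c0 [set c | endpoint c = xi].
  apply: contrapT => h; apply: nis.
  suff : open [set c : geodesic_ray X | endpoint c = xi] by [].
  rewrite openE => c cxi; apply: contrapT => nn; apply: h; by exists c.
pose o := ray_at c0 0.
(* The first part bounds the distance from c' to c0 up to time n, the second one
   the distance from c0 to g c0, whose origins are B + 2 d(o, x) apart. *)
pose M := 3 * 1 + 4 * delta + (3 * (B + 2 * d o x) + 4 * delta).
have [n nK] : exists n, forall zeta, K zeta -> ~ fellow_classes c0 M n zeta.
  have /compact_near_coveringP/(_ nat \oo
    (fun n zeta => ~ fellow_classes c0 M n zeta)) := Kc.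
  move=> /(_ _ _)[].
    move=> zeta Kz.
    have [N nN] : exists N, ~ fellow_classes c0 M N zeta.
      apply: contrapT => /forallNP h; apply: (Kxi _ Kz) => /=.
      rewrite -c0xi; apply: (fellow_classes_point Xproper d4 delta0 (M := M)) => N.
      exact: contrapT (h N).
    exists (~` fellow_classes c0 M N, [set n | (N <= n)%N]) => /=.
      split; last exact: nbhs_infty_ge.
      apply: open_nbhs_nbhs; split => //; rewrite openC.
      exact: fellow_classes_closed.
    move=> [zeta' n] /= [nz Nn] [e ez eM]; apply: nz; exists e => // t /andP[t0 tN].
    by apply: eM; rewrite t0 (le_trans tN) // ler_nat.
  by move=> n _ /(_ n (leqnn n)) h; exists n.
have [c' [[h0 hn] c'xi]] : exists c', [/\ d (ray_at c' 0) (ray_at c0 0) < 1 &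
    d (ray_at c' n%:R) (ray_at c0 n%:R) < 1] /\ endpoint c' <> xi.
  apply: contrapT => h; apply: nnb.
  apply: filterS (filterI (near_ray_at c0 0 ltr01) (near_ray_at c0 n%:R ltr01)).
  by move=> c /= [? ?]; apply: contrapT => ?; apply: h; exists c.
have : (~` [set xi]) (endpoint c') by [].
rewrite -KG => -[g gxi [zeta Kz /boundary_act_inv zc']].
apply: (nK zeta Kz); exists (ray_act a g^-1%g c') => // t /andP[t0 tn].
rewrite ray_at_act mdist_iactV -ray_at_act.
apply: le_trans (metric_triangle _ (ray_at c0 t) _) (lerD _ _).
  by apply: (fellow_travel d4 delta0 (s := n%:R)); rewrite ?t0 //; lra.
have := gxi; rewrite -c0xi => /boundary_stabilizer_asymptotic.
rewrite asymptotic_sym => /(asymptotic_close d4 delta0)/(_ t0) h.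
apply: le_trans h _; rewrite lerD2r ler_pM2l // ray_at_act -/o.
have := gB g gxi; have := metric_triangle o x (a g o).
have := metric_triangle x (a g x) (a g o); rewrite iact_isometry (metric_sym x o).
by lra.
Qed.

(** Let g x be close to c s with s large. Seen from o = e 0, the directions of
    c and e diverge, so o is near a geodesic from p = g o to the endpoint of e.
    The ray g e is such a geodesic since g fixes this endpoint. Hence
    g^-1 o is close to the point of e at time d(p, o). *)
Lemma fixed_point_conical (c e : geodesic_ray X) :
  (forall g, boundary_stabilizer a (endpoint e) g) ->
  endpoint c <> endpoint e -> conical_limit_point a (endpoint c) ->
  conical_limit_point a (endpoint e).
Proof.
move=> Gfix ce /conical_unbounded[c1 [x [r [c1c r0 c1r]]]].
have {ce} nas : ~~ asymptotic e c1.
  by apply/negP => /endpointP h; apply: ce; rewrite h c1c.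
have [T0 hT0] := not_asymptotic_excess d4 delta0 nas.
pose o := ray_at e 0; pose D := d o (ray_at c1 0).
pose r1 := r + d x o.
pose k := T0 + 2 * D + 2 * r1 + 2 * delta.
have dl0 := delta0.
apply: (@conical_of_unbounded e o (`|k + 2 * delta| + 1)).
  by have := normr_ge0 (k + 2 * delta); lra.
move=> [M hM]; apply: c1r; exists (M + d x o + D) => g s s0 gs.
pose p := a g o.
have ps : d p (ray_at c1 s) < r1.
  have := metric_triangle p (a g x) (ray_at c1 s).
  by rewrite iact_isometry (metric_sym o x) /r1; lra.
suff poM : d p o <= M.
  have := metric_triangle (a g x) p (ray_at c1 0).
  have := metric_triangle p o (ray_at c1 0).
  by rewrite iact_isometry -/D; lra.
have D0 : 0 <= D := mdist_ge0 _ _.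
have po0 : 0 <= d p o := mdist_ge0 _ _.
have r10 : 0 <= r1 by have := mdist_ge0 x o; rewrite /r1; lra.
have T00 : 0 <= T0.
  by apply: le_trans (hT0 0 (lexx 0)); rewrite /excess subr_ge0; exact: metric_triangle.
(* Seen from o, the points of e and of g e at time u are in the same direction,
   and u exceeds s and d(p, o). *)
pose u := s + k + 2 * delta + 4 * d p o + 4 * delta + 1.
have k0 : 0 <= k by rewrite /k; lra.
have u0 : 0 <= u by rewrite /u; lra.
have ge : asymptotic e (ray_act a g e).
  by rewrite asymptotic_sym; apply: boundary_stabilizer_asymptotic; exact: Gfix.
have ex : excess p o (ray_at e u) <= k - 2 * delta.
  have h1 := hT0 u u0; have h2 := ray_dist0 c1 u0; have h3 := ray_dist0 c1 s0.
  have h4 : d (ray_at c1 s) (ray_at c1 u) = u - s.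
    by rewrite ray_dist_le // s0 /u; lra.
  have h5 := metric_triangle (ray_at c1 0) o (ray_at c1 u).
  have h6 := metric_triangle o (ray_at c1 0) (ray_at c1 s).
  have h7 := metric_triangle o (ray_at c1 s) p.
  have h8 := metric_triangle (ray_at c1 u) (ray_at c1 s) (ray_at e u).
  have h9 := metric_triangle (ray_at c1 s) p (ray_at e u).
  rewrite (metric_sym (ray_at c1 0) o) -/D in h5.
  rewrite -/D in h6.
  rewrite (metric_sym (ray_at c1 s) p) in h7 h9.
  rewrite (metric_sym (ray_at c1 u) (ray_at c1 s)) in h8.
  rewrite (metric_sym (ray_at c1 u) (ray_at e u)) in h8.
  move: h1; rewrite /excess -/o (metric_sym (ray_at e u) o) (metric_sym p o) /k.
  by move=> h1; lra.
have ex2 : excess p o (ray_at (ray_act a g e) u) <= k.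
  have -> : k = k - 2 * delta + 2 * delta by lra.
  apply: excess_swap d4 _ _ _ _ _ ex _.
  have := asymptotic_excess d4 delta0 o ge u0.
  rewrite -/o mdistxx ray_at_act -/p (metric_sym o p).
  by rewrite /u; lra.
have h : d o (ray_at (ray_act a g e) (d p o)) <= k + 2 * delta.
  by apply: (excess_close_to_ray d4 delta0 (c := ray_act a g e) u0 _ ex2); rewrite -/p /u; lra.
have := hM g^-1%g (d p o) po0; rewrite -/o !mdist_iactV -/p (metric_sym o p); apply.
rewrite -ray_at_act; have := ler_norm (k + 2 * delta); lra.
Qed.

End hyperbolic.
End boundary_dynamics.

(** * Invariant means and parabolic points *)

Section means.
Context (R : realType) (G : topologicalGroupType).
Variable m : (G -> R) -> R.
Hypothesis mP : @left_invariant_mean R G m.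
Local Notation bc := (@bounded_continuous R G).

Lemma bounded_continuousP (f : G -> R) :
  bc f <-> continuous f /\ exists M, forall x, `|f x| <= M.
Proof.
have GP : ProperFilter (globally [set: G]) := @globally_properfilter _ setT 1%g I.
split=> -[fc].
  by move=> /ex_bound[M fM]; split=> //; exists M => x; exact: fM.
by move=> [M fM]; split=> //; apply/ex_bound; exists M => x _; exact: fM.
Qed.

Lemma bounded_continuous_lin b f h : bc f -> bc h -> bc (fun x => b * f x + h x).
Proof.
move=> /bounded_continuousP[fc [M fM]] /bounded_continuousP[hc [N hN]].
apply/bounded_continuousP; split.
  move=> x; apply: cvgD; last exact: hc.
  by apply: cvgM; [exact: cvg_cst|exact: fc].
exists (`|b| * M + N) => x; apply: le_trans (ler_normD _ _) _.
by apply: lerD (hN x); rewrite normrM ler_wpM2l.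
Qed.

Lemma bounded_continuous_cst b : bc (fun=> b).
Proof.
by apply/bounded_continuousP; split; [move=> x; exact: cvg_cst|exists `|b|].
Qed.

Lemma bounded_continuous_shift g f : bc f -> bc (fun x => f (g * x)%g).
Proof.
move=> /bounded_continuousP[fc [M fM]]; apply/bounded_continuousP.
split; last by exists M => x; exact: fM.
move=> x; apply: continuous_comp; last exact: fc.
apply: (@continuous_comp _ _ _ (fun x => (g, x)) (fun p : G * G => (p.1 * p.2)%g)).
  by apply: cvg_pair => //=; exact: cvg_cst.
exact: mulg_continuous.
Qed.

Lemma mean_disjoint_translates f g h : bc f ->
  (forall x, f x + f (g * x)%g + f (h * x)%g <= 1) -> 3 * m f <= 1.
Proof.
move=> fb f1; have [mlin mpos m1 minv] := mP.
have gb := bounded_continuous_shift g fb; have hb := bounded_continuous_shift h fb.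
have oneb := bounded_continuous_cst 1.
have hb1 := bounded_continuous_lin (-1) hb oneb.
have gb1 := bounded_continuous_lin (-1) gb hb1.
have := mpos _ (bounded_continuous_lin (-1) fb gb1).
rewrite (mlin _ _ _ fb gb1) (mlin _ _ _ gb hb1) (mlin _ _ _ hb oneb) m1 !minv //.
have pos x : 0 <= -1 * f x + (-1 * f (g * x)%g + (-1 * f (h * x)%g + 1)).
  by have := f1 x; lra.
by move=> /(_ pos); lra.
Qed.

Lemma mean_cover f h : bc f -> bc h -> (forall x, 1 <= f x + h x) -> 1 <= m f + m h.
Proof.
move=> fb hb f1; have [mlin mpos m1 minv] := mP.
have oneb := bounded_continuous_cst 1.
have hb1 := bounded_continuous_lin (-1) oneb hb.
have := mpos _ (bounded_continuous_lin 1 fb hb1).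
rewrite (mlin _ _ _ fb hb1) (mlin _ _ _ oneb hb) m1.
have pos x : 0 <= 1 * f x + (-1 * 1 + h x) by have := f1 x; lra.
by move=> /(_ pos); lra.
Qed.

End means.

Section bump.
Context (R : realType) (X : metricType R).
Local Notation d := (@mdist R X).
Local Notation excess := (excess d).

(** A continuous substitute for the indicator function of the points y such
    that excess y o z <= k. When z is far along a ray from o to xi, these are
    the points outside a neighbourhood of xi. *)
Definition bump (o z : X) (k : R) (y : X) : R :=
  Num.max 0 (Num.min 1 (k + 1 - excess y o z)).

Lemma bump_ge0 o z k y : 0 <= bump o z k y.
Proof. by rewrite /bump le_max lexx. Qed.

Lemma bump_le1 o z k y : bump o z k y <= 1.
Proof. by rewrite /bump ge_max ge_min lexx ler01. Qed.

Lemma bump_out o z k y : k + 1 < excess y o z -> bump o z k y = 0.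
Proof.
by move=> h; apply/eqP; rewrite eq_le bump_ge0 andbT ge_max lexx ge_min; lra.
Qed.

Lemma bump_in o z k y : excess y o z <= k -> bump o z k y = 1.
Proof.
move=> h; apply/eqP; rewrite eq_le bump_le1 /=.
by rewrite le_max le_min lexx /=; apply/orP; right; lra.
Qed.

Lemma bump_continuous o z k : continuous (bump o z k).
Proof.
have lip y y' : bump o z k y - bump o z k y' <= 2 * d y y'.
  have h1 := metric_triangle y' y o; have h2 := metric_triangle y y' z.
  have h3 := metric_sym y y'; have d0 := mdist_ge0 y y'.
  have h4 := bump_ge0 o z k y'.
  rewrite lerBlDr {1}/bump ge_max ge_min; apply/andP; split; first lra.
  rewrite /excess; have [h|h] := lerP 1 (k + 1 - excess y' o z).
    have b1 : 1 <= bump o z k y' by rewrite /bump le_max le_min lexx h orbT.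
    by apply/orP; left; lra.
  have b1 : k + 1 - excess y' o z <= bump o z k y'.
    by rewrite /bump le_max le_min lexx (ltW h) orbT.
  by apply/orP; right; rewrite /excess in b1; lra.
move=> y; apply/cvgrPdist_lt => e e0; near=> y'.
have yy : d y y' < e / 2 by near: y'; apply/nbhs_ballP; exists (e / 2)
  => /=; [lra|rewrite ballEmdist].
rewrite ltr_norml; have := lip y y'; have := lip y' y; rewrite (metric_sym y' y).
by move=> ? ?; apply/andP; split; lra.
Unshelve. all: by end_near.
Qed.

End bump.

Section concentration.
Context (R : realType) (G : topologicalGroupType) (X : metricType R).
Variable a : isometric_action G X.
Local Notation d := (@mdist R X).
Local Notation excess := (excess d).
Variable delta : R.
Hypothesis d4 : four_point d delta.
Hypothesis delta0 : 0 <= delta.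

(** A point y with both excesses at most k would make the rays g c and h c,
    which tend to the same point, share a shadow; then h^-1 g or g^-1 h would
    bring the origin of c close to c, against the assumption that such orbit
    points stay within M of the origin. *)
Lemma disjoint_shadows (c : geodesic_ray X) k M g h :
  (forall g s, 0 <= s -> d (a g (ray_at c 0)) (ray_at c s) < k + 6 * delta + 1 ->
     d (a g (ray_at c 0)) (ray_at c 0) <= M) ->
  boundary_stabilizer a (endpoint c) g -> boundary_stabilizer a (endpoint c) h ->
  M < d (a g (ray_at c 0)) (a h (ray_at c 0)) ->
  exists t0, forall t, t0 <= t -> forall y,
    k < excess (a g^-1%g y) (ray_at c 0) (ray_at c t) \/
    k < excess (a h^-1%g y) (ray_at c 0) (ray_at c t).
Proof.
move=> cM gc hc gh.
have {gc hc} gch : asymptotic (ray_act a g c) (ray_act a h c).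
  apply: asymptotic_trans (boundary_stabilizer_asymptotic gc) _.
  by rewrite asymptotic_sym; exact: boundary_stabilizer_asymptotic.
exists (`|k| + 8 * delta + 4 * d (a g (ray_at c 0)) (a h (ray_at c 0)) + 1) => t t0t y.
have kn := ler_norm k; have kn0 := normr_ge0 k; have dl0 := delta0.
have d0 := mdist_ge0 (a g (ray_at c 0)) (a h (ray_at c 0)).
have t0 : 0 <= t by lra.
have [|ky] := ltrP k (excess (a g^-1%g y) (ray_at c 0) (ray_at c t)); first by left.
have [|kh] := ltrP k (excess (a h^-1%g y) (ray_at c 0) (ray_at c t)); first by right.
exfalso; rewrite -(excess_act a g) iactKV in ky; rewrite -(excess_act a h) iactKV in kh.
have [|s [s0 gs]] := common_shadow d4 delta0 gch t0 _ ky kh.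
  by rewrite !ray_at_act; lra.
have lt1 : k + 6 * delta < k + 6 * delta + 1 by lra.
rewrite !ray_at_act in gs; case: gs => gs.
- have := cM (h^-1 * g)%g s s0; rewrite !iactM !mdist_iactV.
  by move=> /(_ (le_lt_trans gs lt1)); lra.
- have := cM (g^-1 * h)%g s s0; rewrite !iactM !mdist_iactV.
  by move=> /(_ (le_lt_trans gs lt1)); rewrite metric_sym; lra.
Qed.

(** With 1, g and h in the stabilizer moving the origin of c by amounts that are
    far apart, the three translates of the bump function have disjoint
    supports. *)
Lemma mean_concentrates (m : (G -> R) -> R) (c : geodesic_ray X) x k :
  left_invariant_mean m -> continuous_action a ->
  ~ conical_limit_point a (endpoint c) ->
  (forall B, exists2 g, boundary_stabilizer a (endpoint c) g &
     B < d (ray_at c 0) (a g (ray_at c 0))) -> 0 <= k ->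
  exists t0, forall t, t0 <= t ->
    3 * m (fun g => bump (ray_at c 0) (ray_at c t) k (a g x)) <= 1.
Proof.
move=> mP ac nc unb k0; have dl0 := delta0; pose o := ray_at c 0.
have r0 : 0 < k + 1 + 6 * delta + 1 by lra.
have [M cM] : orbit_near_ray_bounded a c o (k + 1 + 6 * delta + 1).
  by apply: contrapT => /(conical_of_unbounded r0).
have M0 : 0 <= M.
  by have := cM 1%g 0 (lexx _); rewrite iact1 mdistxx; apply.
have [g gc gM] := unb M; have [h hc hM] := unb (M + d o (a g o)).
rewrite -/o in gM hM.
have stab1 : boundary_stabilizer a (endpoint c) 1%g.
  rewrite /boundary_stabilizer /= boundary_act_endpoint; congr endpoint.
  by apply: val_inj; apply/funext => t /=; rewrite iact1.
have [|t1 H1] := disjoint_shadows cM stab1 gc; first by rewrite iact1.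
have [|t2 H2] := disjoint_shadows cM stab1 hc.
  by rewrite iact1 -/o; have := mdist_ge0 o (a g o); lra.
have [|t3 H3] := disjoint_shadows cM gc hc.
  by rewrite -/o; have := metric_triangle o (a g o) (a h o); lra.
exists (Num.max t1 (Num.max t2 t3)) => t; rewrite !ge_max => /and3P[t1t t2t t3t].
have fb : @bounded_continuous R G (fun g => bump o (ray_at c t) k (a g x)).
  apply/bounded_continuousP; split.
    move=> g1; apply: (@continuous_comp _ _ _ (a^~ x)).
      exact: action_continuous.
    exact: bump_continuous.
  by exists 1 => g1; rewrite ger0_norm ?bump_ge0 ?bump_le1.
apply: (@mean_disjoint_translates _ _ _ mP _ g^-1%g h^-1%g) => // u.
have := H1 t t1t (a u x); have := H2 t t2t (a u x); have := H3 t t3t (a u x).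
rewrite invg1 iact1 -!iactM -/o.
set e1 := excess (a u x) _ _; set e2 := excess (a (g^-1 * u)%g x) _ _.
set e3 := excess (a (h^-1 * u)%g x) _ _.
have := bump_le1 o (ray_at c t) k (a u x).
have := bump_le1 o (ray_at c t) k (a (g^-1 * u)%g x).
have := bump_le1 o (ray_at c t) k (a (h^-1 * u)%g x).
move=> b3 b2 b1 [/bump_out ->|/bump_out ->] [/bump_out e|/bump_out e]
  [/bump_out e'|/bump_out e'];
  rewrite ?e ?e'; lra.
Qed.

(** Far along two rays with different endpoints, no y is in both directions, so
    one of the two bumps is 1 at y. The masses, at most 1/3 each, would add
    up to at least 1. *)
Lemma concentration_unique (m : (G -> R) -> R) (c e : geodesic_ray X) :
  left_invariant_mean m -> continuous_action a ->
  ~ conical_limit_point a (endpoint c) -> ~ conical_limit_point a (endpoint e) ->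
  (forall B, exists2 g, boundary_stabilizer a (endpoint c) g &
     B < d (ray_at c 0) (a g (ray_at c 0))) ->
  (forall B, exists2 g, boundary_stabilizer a (endpoint e) g &
     B < d (ray_at e 0) (a g (ray_at e 0))) ->
  endpoint c = endpoint e.
Proof.
move=> mP ac nc ne uc ue; apply/endpointP; apply: contrapT => /negP nce.
have [T HT] := not_asymptotic_excess d4 delta0 nce.
pose o := ray_at c 0; pose o' := ray_at e 0.
(* Replacing the base point o by o' changes an excess by at most 2 d(o, o'). *)
pose k := `|T| + 2 * delta + 2 * d o o'; have dl0 := delta0.
have d0 := mdist_ge0 o o'; have T0 := normr_ge0 T; have TT := ler_norm T.
have k0 : 0 <= k by rewrite /k; lra.
have [tc hc] := mean_concentrates o mP ac nc uc k0.
have [te he] := mean_concentrates o mP ac ne ue k0.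
pose t := `|tc| + `|te|.
have tct : tc <= t by have := ler_norm tc; have := normr_ge0 te; rewrite /t; lra.
have tet : te <= t by have := ler_norm te; have := normr_ge0 tc; rewrite /t; lra.
have t0 : 0 <= t by rewrite addr_ge0.
have bb o1 z : @bounded_continuous R G (fun g => bump o1 z k (a g o)).
  apply/bounded_continuousP; split.
    move=> g1; apply: (@continuous_comp _ _ _ (a^~ o)).
      exact: action_continuous.
    exact: bump_continuous.
  by exists 1 => g1; rewrite ger0_norm ?bump_ge0 ?bump_le1.
have : 1 <= m (fun g => bump o (ray_at c t) k (a g o)) +
            m (fun g => bump o' (ray_at e t) k (a g o)).
  apply: mean_cover => // u; set y := a u o.
  have h0 := bump_ge0 o (ray_at c t) k y; have h0' := bump_ge0 o' (ray_at e t) k y.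
  have [h|h] := lerP (excess y o (ray_at c t)) k.
    by rewrite (bump_in h) lerDl.
  have [h'|h'] := lerP (excess y o' (ray_at e t)) k.
    by rewrite (bump_in h') lerDr.
  exfalso; have := HT t t0; rewrite /excess -/o in h h' * => hT.
  have h1 := metric_triangle y o o'; have h2 := metric_triangle o' o (ray_at e t).
  rewrite /k in h h'; have s1 := metric_sym o o'.
  have s2 := metric_sym y o; have s3 := metric_sym (ray_at c t) o.
  have s4 := metric_sym (ray_at c t) y.
  by case: (d4 o (ray_at c t) y (ray_at e t)) => ?; lra.
by have := hc t tct; have := he t tet; rewrite -/o -/o'; lra.
Qed.

End concentration.

(** * Amenable relatively hyperbolic groups *)

Lemma conical_boundary_act (R : realType) (G : topologicalGroupType)
    (X : metricType R) (a : isometric_action G X) g xi :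
  conical_limit_point a (boundary_act a g xi) -> conical_limit_point a xi.
Proof.
move=> /conical_unbounded[c [x [r [/esym/boundary_act_inv -> r0 cr]]]].
apply: (conical_of_unbounded r0 (x := x)) => -[M hM]; apply: cr.
exists M => h s s0 hs; have := hM (g^-1 * h)%g s s0.
by rewrite !ray_at_act iactM !iact_isometry; apply.
Qed.

Theorem theorem6 (R : realType) (G : topologicalGroupType) :
  locally_compact_group G -> amenable R G ->
  relatively_hyperbolic R G -> hyperbolic_group R G.
Proof.
move=> _ [m mP] [X [a [[X0 Xp Xg Xh] [ac ap cu]]]].
have [delta delta0 d4] := hyperbolic_four_point_ge0 Xh.
apply: (cobounded_hyperbolic_group Xp Xg Xh ac ap).
apply: conical_cobounded => // xi; apply: contrapT => nxi.
have parabolic zeta : ~ conical_limit_point a zeta ->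
    ~ isolated_point zeta /\ bounded_parabolic a zeta.
  by have [|] := cu zeta.
have unique zeta : ~ conical_limit_point a zeta -> zeta = xi.
  have [c cxi] := endpoint_surj xi; have [e ez] := endpoint_surj zeta.
  rewrite -cxi in nxi *; rewrite -ez => nz.
  have [ni bp] := parabolic _ nxi; have [ni' bp'] := parabolic _ nz.
  apply: (concentration_unique d4 delta0 mP ac nz nxi).
    exact: parabolic_unbounded.
  exact: parabolic_unbounded.
have fixed g : boundary_stabilizer a xi g.
  by apply: unique => /conical_boundary_act.
have [zeta zxi] : exists zeta, zeta <> xi.
  apply: contrapT => h; apply: (parabolic _ nxi).1; rewrite /isolated_point.
  suff -> : [set xi] = setT by exact: openT.
  by apply/seteqP; split => // zeta _ /=; apply: contrapT => zxi; apply: h; exists zeta.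
have con : conical_limit_point a zeta by apply: contrapT => /unique.
have [c cz] := endpoint_surj zeta; have [e exi] := endpoint_surj xi.
rewrite -cz -exi in zxi con fixed nxi.
by apply: nxi; exact: (fixed_point_conical d4 delta0 fixed zxi con).
Qed.
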